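(* For every oriented graph $H$ with $\mathrm{FAS}(H)=1$ there is a constant $\gamma=\gamma(H)>0$ such that for every positive integer $n$ with $\gamma n\geq 1$, in the $\lfloor\gamma n\rfloor$-biased orientation game on the edges of $K_n$ Maker has a strategy guaranteeing that the obtained tournament contains a copy of $H$.
   Context: An oriented graph is a finite directed graph with no loops, no parallel edges and no pair of opposite edges. For an oriented graph $H$ and a bijection $\sigma: V(H)\to\{1,\dots,|V(H)|\}$ let $\mathrm{FAS}(H,\sigma)=|\{(u,v)\in E(H):\sigma(u)>\sigma(v)\}|$, where $(u,v)$ denotes the edge directed from $u$ to $v$, and let $\mathrm{FAS}(H)=\min_\sigma \mathrm{FAS}(H,\sigma)$. A copy of $H$ in a tournament is a (not necessarily induced) directed subgraph isomorphic to $H$. The $b$-biased (i.e. $(1:b)$) orientation game on $K_n$: two players, Maker and Breaker, take turns in orienting previously undirected edges of the complete graph $K_n$. Maker starts. In each round Maker orients exactly one previously undirected edge, and then Breaker orients at least one and at most $b$ previously undirected edges (if any remain). The game ends when all edges are oriented, so that a tournament is obtained. A copy of $H$ counts no matter which player oriented each of its edges. *)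

(* Defs.v *)
From mathcomp Require Import all_boot.

Set Implicit Arguments.
Unset Strict Implicit.
Unset Printing Implicit Defensive.

Definition oriented_graph (V : finType) (E : rel V) : Prop :=
  irreflexive E /\ forall u v : V, ~~ (E u v && E v u).

Section FeedbackArcSet.
Variables (V : finType) (E : rel V).

(* Positions are numbered 0, ..., #|V| - 1 rather than 1, ..., #|V|. *)
Definition FAS_ord (sigma : {ffun V -> 'I_#|V|}) : nat :=
  #|[set e : V * V | E e.1 e.2 && (sigma e.2 < sigma e.1)]|.

(* As V and 'I_#|V| have the same cardinality, the injective maps between them
   are exactly the bijections; enum_rank only witnesses that there is one. *)
Definition FAS : nat :=
  FAS_ord [arg min_(sigma < [ffun v => enum_rank v] | injectiveb sigma)
             FAS_ord sigma].

End FeedbackArcSet.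

Section OrientationGame.
Variable n : nat.

(* (u, v) stands for the edge uv of K_n directed from u to v. *)
Definition dedge : Type := ('I_n * 'I_n)%type.

Definition swap (a : dedge) : dedge := (a.2, a.1).

Implicit Types (D A : {set 'I_n * 'I_n}) (a : dedge).

Definition undirected D a : bool :=
  [&& a.1 != a.2, a \notin D & swap a \notin D].

Definition game_over D : bool := [forall a : 'I_n * 'I_n, ~~ undirected D a].

(* The empty answer is allowed only when Maker has just oriented the last
   edge. *)
Definition breaker_move (b : nat) D A : bool :=
  if game_over D then A == set0
  else [&& 0 < #|A|, #|A| <= b,
           [forall a in A, undirected D a]
         & [forall a in A, swap a \notin A]].

(* The sequence of rounds played so far, oldest first: Maker's edge, then
   the set of edges oriented by Breaker in answer. *)
Definition history : Type := seq (dedge * {set 'I_n * 'I_n}).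

Definition position (h : history) : {set 'I_n * 'I_n} :=
  \bigcup_(r <- h) (r.1 |: r.2).

Definition maker_strategy : Type := history -> dedge.

Inductive play (b : nat) (S : maker_strategy) : history -> Prop :=
| play_start : play b S [::]
| play_round (h : history) (A : {set 'I_n * 'I_n}) :
    play b S h -> ~~ game_over (position h) ->
    breaker_move b (S h |: position h) A ->
    play b S (rcons h (S h, A)).

Definition legal_strategy (b : nat) (S : maker_strategy) : Prop :=
  forall h : history, play b S h -> ~~ game_over (position h) ->
    undirected (position h) (S h).

Definition has_copy (V : finType) (E : rel V) (T : {set 'I_n * 'I_n}) : Prop :=
  exists2 f : V -> 'I_n,
    injective f & forall u v : V, E u v -> (f u, f v) \in T.

Definition maker_wins (b : nat) (V : finType) (E : rel V) : Prop :=
  exists2 S : maker_strategy, legal_strategy b S &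
    forall h : history, play b S h -> game_over (position h) ->
      has_copy E (position h).

End OrientationGame.

(* Main.v *)
Require Import Defs.
From mathcomp Require Import all_boot all_order all_algebra.
From mathcomp Require Import reals.
From mathcomp Require Import lra ring zify.

Set Implicit Arguments.
Unset Strict Implicit.
Unset Printing Implicit Defensive.

Import Order.TTheory GRing.Theory Num.Theory.
Local Open Scope ring_scope.

(** An ordering of [V] with a single backward edge [a -> c] shows that the other
    edges of the graph form an acyclic graph [F].  Acyclic graphs are
    unavoidable in large tournaments, and robustly so: a tournament on [n]
    vertices contains at least a fixed positive proportion of all the possible
    copies of [F].  Averaging over these copies, all vertices other than [a]
    and [c] can be placed in such a way that linearly large disjoint sets [X]
    and [Y] of candidates for [a] and [c] remain, any choice from [X] and [Y]
    completing a copy of [F] (lemma [two_free_vertices]).  As [a] and [c] are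
    not adjacent in [F], nothing is known about the edges between [X] and [Y],
    and one edge from [X] to [Y] is all that is missing.

    Maker's only task is therefore to make sure that for all large disjoint
    sets [X] and [Y] some edge goes from [X] to [Y].  This is a game in which
    Breaker tries to orient all the edges of some such rectangle backwards, and
    Maker wins it by the potential argument of Erdos, Selfridge and Beck
    ([maker_controls_potential], [low_potential_edge]).  There are at most
    [4 ^ n] rectangles, and those that matter have at least [delta * n ^ 2]
    edges, where [delta > 0] depends on the graph only; with bias [b] the argument succeeds as soon as
    [2 ^ (delta * n ^ 2 / (2 * (b + 1)))] exceeds [4 ^ n], that is, for every
    [b] below a small multiple of [n]. *)

(** * Strategies that maintain an invariant *)

Section StrategyFromInvariant.
Variables (n b : nat).
Implicit Types (D A : {set 'I_n * 'I_n}) (h : history n).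

Lemma position_rcons h e A : position (rcons h (e, A)) = A :|: (e |: position h).
Proof. by rewrite /position big_rcons /= setUC -setUA setUCA. Qed.

Lemma strategy_of_invariant (Inv : pred {set 'I_n * 'I_n}) :
    (0 < n)%N -> Inv set0 ->
    (forall D, Inv D -> ~~ game_over D ->
       exists2 e : dedge n, undirected D e &
         forall A, breaker_move b (e |: D) A -> Inv (A :|: (e |: D))) ->
  exists2 S : maker_strategy n, legal_strategy b S &
    forall h, play b S h -> Inv (position h).
Proof.
move=> n_gt0 Inv0 step.
pose good D e := undirected D e &&
  [forall A, breaker_move b (e |: D) A ==> Inv (A :|: (e |: D))].
pose S h : dedge n :=
  odflt (Ordinal n_gt0, Ordinal n_gt0) [pick e | good (position h) e].
have goodS h : Inv (position h) -> ~~ game_over (position h) ->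
    good (position h) (S h).
  move=> Ih go; rewrite /S; case: pickP => [e //|noe].
  have [e ue He] := step _ Ih go.
  by have /negP[] := negbT (noe e); rewrite /good ue; apply/forallP=> A; apply/implyP/He.
have InvS h : play b S h -> Inv (position h).
  elim=> [|h' A _ Ih go brk]; first by rewrite /position big_nil.
  have /andP[_ /forallP/(_ A)/implyP HA] := goodS _ Ih go.
  by rewrite position_rcons HA.
exists S => // h ph go.
by have /andP[] := goodS _ (InvS _ ph) go.
Qed.

End StrategyFromInvariant.

(** * The potential of a position *)

Section Potential.
Variables (n b : nat).
Implicit Types (D A : {set 'I_n * 'I_n}) (P : {set 'I_n} * {set 'I_n}) (e : dedge n).

(** Erdos-Selfridge weights with bias [p] would use the growth rate
    [2 ^ (1 / p)].  The value [1 + 1 / (2 * p)] is rational and still satisfies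
    both inequalities that are used, [growth_exp_le] and [exp2_le_growth].
    Here [p = b + 1], because the edge that Maker orients also damages
    rectangles, namely those that contain its reversal. *)
Definition growth : rat := 1 + (b.+1.*2)%:R^-1.

(** A pair [P] stands for the rectangle of all edges from [P.1] to [P.2].  The
    two sets may overlap or be small: this keeps the bound on the number of
    rectangles trivial, and [low_potential_edge] looks at large disjoint sets
    only. *)
Definition missed D P : bool := [disjoint setX P.1 P.2 & D].

Definition reversed D P : nat := #|setX P.2 P.1 :&: D|.

Definition potential D : rat := \sum_(P | missed D P) growth ^+ reversed D P.

(** The amount by which the potential drops when [e] is oriented, apart from the
    growth of the rectangles that contain the reversal of [e]. *)
Definition threat D e : rat :=
  \sum_(P | missed D P && (e \in setX P.1 P.2)) growth ^+ reversed D P.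

Lemma growth_ge1 : 1 <= growth.
Proof. by rewrite lerDl invr_ge0. Qed.

(** The linear bound makes the damage done in one round additive over the edges
    of that round. *)
Lemma growth_exp_le r : (r <= b.+1)%N -> growth ^+ r <= 1 + r%:R / b.+1%:R.
Proof.
elim: r => [|r IH] ltrb; first by rewrite expr0 mul0r addr0.
have {}IH := IH (ltnW ltrb).
rewrite exprS {1}/growth -muln2 natrM.
set c : rat := b.+1%:R in IH *.
have c0 : 0 < c by rewrite ltr0n.
have rc : r%:R / c <= 1 by rewrite ler_pdivrMr // mul1r ler_nat ltnW.
have -> : r.+1%:R / c = r%:R / c + c^-1 by rewrite -addn1 natrD mulrDl mul1r.
have -> : (c * 2)^-1 = c^-1 / 2 by rewrite invfM.
have d0 : 0 <= c^-1 by rewrite invr_ge0 ltW.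
have : (1 + c^-1 / 2) * growth ^+ r <= (1 + c^-1 / 2) * (1 + r%:R / c).
  by apply: ler_wpM2l => //; rewrite addr_ge0 // divr_ge0.
have : 0 <= c^-1 * (1 - r%:R / c) by rewrite mulr_ge0 // subr_ge0.
move: (growth ^+ r) => y.
move: (r%:R / c) => t; move: (c^-1) => d; lra.
Qed.

(** Bernoulli's inequality, in blocks of [2 * (b + 1)] factors. *)
Lemma exp2_le_growth m : 2 ^+ m <= growth ^+ (b.+1.*2 * m).
Proof.
rewrite exprM lerXn2r ?nnegrE ?exprn_ge0 ?(le_trans _ growth_ge1) //.
have bern k (d : rat) : 0 <= d -> 1 + k%:R * d <= (1 + d) ^+ k.
  move=> d0; elim: k => [|k IH]; first by rewrite mul0r addr0.
  have : (1 + d) * (1 + k%:R * d) <= (1 + d) ^+ k.+1.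
    by rewrite exprS ler_wpM2l // addr_ge0.
  have : 0 <= k%:R * d * d by rewrite !mulr_ge0.
  rewrite -addn1 natrD; lra.
apply: le_trans (bern _ _ _); last by rewrite invr_ge0.
by rewrite mulfV ?pnatr_eq0.
Qed.

Lemma threat_ge0 D e : 0 <= threat D e.
Proof. by apply: sumr_ge0 => P _; rewrite exprn_ge0 // (le_trans _ growth_ge1). Qed.

Lemma potential0 : potential set0 <= 4 ^+ n.
Proof.
rewrite /potential (eq_bigr (fun=> 1)); last first.
  by move=> P _; rewrite /reversed setI0 cards0.
rewrite sumr_const.
apply: le_trans (_ : #|{: {set 'I_n} * {set 'I_n}}|%:R <= _).
  by rewrite ler_nat max_card.
have cardT : #|{set 'I_n}| = (2 ^ n)%N.
  by rewrite -cardsT -powersetT card_powerset cardsT card_ord.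
by rewrite card_prod cardT -expnMn -natrX.
Qed.

(** Counting pairs (edge of [A], rectangle that it damages) in two ways: an edge
    damages exactly the rectangles that contain its reversal. *)
Lemma sum_overlap D A :
  \sum_(P | missed D P) growth ^+ reversed D P * #|setX P.2 P.1 :&: A|%:R
  = \sum_(a in A) threat D (swap a).
Proof.
rewrite /threat (exchange_big_dep (missed D)) /=; last by move=> a P _ /andP[].
apply: eq_bigr => P mP; rewrite mulr_natr -sumr_const.
apply: eq_bigl => a.
by rewrite mP !inE /swap /= [(a.1 \in _) && _]andbC andbC.
Qed.

(** The rectangles hit by [e] disappear, which gains [threat D e].  By
    [growth_exp_le] every edge [a] of the round costs at most
    [threat D (swap a) / (b + 1)], and there are at most [b + 1] of them, so the
    gain covers the cost. *)
Lemma potential_step D e A :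
    (#|e |: A| <= b.+1)%N -> (forall a, a \in e |: A -> threat D (swap a) <= threat D e) ->
  potential (A :|: (e |: D)) <= potential D.
Proof.
set A' := e |: A => cA maxe.
have -> : A :|: (e |: D) = A' :|: D by rewrite setUA (setUC A).
have g1 := growth_ge1; have g0 : 0 <= growth by apply: le_trans g1.
set hit := [pred P : {set 'I_n} * {set 'I_n} | e \in setX P.1 P.2].
set ov := fun P => #|setX P.2 P.1 :&: A'|.
have lePhi : potential (A' :|: D) <=
    \sum_(P | missed D P && ~~ hit P)
       (growth ^+ reversed D P + growth ^+ reversed D P * (ov P)%:R / b.+1%:R).
  rewrite /potential big_mkcond [leRHS]big_mkcond; apply: ler_sum => P _.
  have [|_] := boolP (missed (A' :|: D) P); last first.
    case: ifP => // _; rewrite addr_ge0 ?exprn_ge0 // divr_ge0 // mulr_ge0 //.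
    exact: exprn_ge0.
  rewrite {1}/missed => dis.
  have [disA disD] : [disjoint setX P.1 P.2 & A'] /\ [disjoint setX P.1 P.2 & D].
    by split; apply: disjointWr dis; rewrite ?subsetUl ?subsetUr.
  rewrite /missed disD /= (disjointFl disA) ?setU11 //=.
  have leR : (reversed (A' :|: D) P <= reversed D P + ov P)%N.
    by rewrite /reversed setIUr addnC leq_card_setU.
  have leov : (ov P <= b.+1)%N by apply: leq_trans cA; rewrite subset_leq_card ?subsetIr.
  apply: le_trans (ler_weXn2l g1 leR) _.
  rewrite exprD -mulrA -[X in _ <= X + _]mulr1 -mulrDr ler_wpM2l ?exprn_ge0 //.
  exact: growth_exp_le.
apply: le_trans lePhi _; rewrite big_split /=.
have -> : potential D = \sum_(P | missed D P && ~~ hit P) growth ^+ reversed D P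
    + threat D e.
  by rewrite /potential (bigID hit) /= addrC.
rewrite lerD2l.
apply: (@le_trans _ _ ((\sum_(a in A') threat D (swap a)) / b.+1%:R)).
  rewrite -sum_overlap mulr_suml [leRHS](bigID hit) /= lerDr.
  by apply: sumr_ge0 => P _; rewrite divr_ge0 // mulr_ge0 // exprn_ge0.
rewrite ler_pdivrMr ?ltr0n //.
apply: (@le_trans _ _ (\sum_(a in A') threat D e)); first exact: ler_sum.
by rewrite sumr_const -[leLHS]mulr_natr ler_wpM2l ?threat_ge0 // ler_nat.
Qed.

Lemma undirected_swap D e : undirected D (swap e) = undirected D e.
Proof. by case: e => u v; rewrite /undirected /swap /= eq_sym [(_ \notin _) && _]andbC. Qed.

Lemma undirectedW D D' e : D \subset D' -> undirected D' e -> undirected D e.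
Proof.
move=> sD /and3P[ne e1 e2]; apply/and3P; split=> //.
  by apply: contra e1; apply: (subsetP sD).
by apply: contra e2; apply: (subsetP sD).
Qed.

(** Maker always orients an edge of maximal threat.  All edges of the same
    round are still undirected at that time, and so are their reversals;
    hence [potential_step] applies. *)
Lemma maker_controls_potential : (0 < n)%N ->
  exists2 S : maker_strategy n, legal_strategy b S &
    forall h, play b S h -> potential (position h) <= 4 ^+ n.
Proof.
move=> n0.
apply: (@strategy_of_invariant n b (fun D => potential D <= 4 ^+ n)) => //.
  exact: potential0.
move=> D ID /forallPn[e0]; rewrite negbK => ue0.
case: (arg_maxP (threat D) ue0) => e ue maxe.
exists e => // A brk; apply: le_trans ID.
have [cA uA] : (#|A| <= b)%N /\ (forall a, a \in A -> undirected (e |: D) a).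
  move: brk; rewrite /breaker_move; case: ifP => _.
    by move/eqP->; rewrite cards0; split=> // a; rewrite inE.
  by case/and4P=> _ -> /forall_inP.
apply: potential_step => [|a]; first by rewrite (leq_trans (leq_card_setU _ _)) // cards1 ltnS.
rewrite in_setU1 => aA; apply: maxe; rewrite undirected_swap.
by case/predU1P: aA => [->//|/uA]; apply/undirectedW/subsetUr.
Qed.

Lemma game_over_edge D u v :
  game_over D -> u != v -> ((u, v) \in D) || ((v, u) \in D).
Proof.
move=> /forallP/(_ (u, v)) + neq.
by rewrite /undirected /swap /= neq /= -negb_or negbK.
Qed.

(** When the game is over, a rectangle of disjoint sides without any edge is
    completely reversed, and if it is large, then its weight alone exceeds
    [4 ^ n]. *)
Lemma low_potential_edge D (X Y : {set 'I_n}) :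
    game_over D -> potential D <= 4 ^+ n -> [disjoint X & Y] ->
    (b.+1.*2 * n.*2.+1 <= #|X| * #|Y|)%N ->
  exists2 x, x \in X & exists2 y, y \in Y & (x, y) \in D.
Proof.
move=> over low dXY big.
have [mis|/pred0Pn[[x y]]] := boolP (missed D (X, Y)); last first.
  by rewrite /= in_setX => /andP[/andP[xX yY] xyD]; exists x => //; exists y.
have rev : reversed D (X, Y) = (#|X| * #|Y|)%N.
  rewrite /reversed /= -[RHS]mulnC -cardsX; congr #|pred_of_set _|; apply/setIidPl/subsetP.
  case=> y x; rewrite in_setX => /andP[yY xX].
  have xy : x != y by apply: contraTneq xX => ->; rewrite (disjointFl dXY).
  case/orP: (game_over_edge over xy) => // xyD.
  by move/disjointFl: mis => /(_ _ xyD); rewrite in_setX xX yY.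
have : growth ^+ reversed D (X, Y) <= 4 ^+ n.
  apply: le_trans low; rewrite /potential (bigD1 (X, Y)) //= lerDl.
  by apply: sumr_ge0 => P _; rewrite exprn_ge0 // (le_trans _ growth_ge1).
have : 2 ^+ n.*2.+1 <= growth ^+ reversed D (X, Y).
  by rewrite rev (le_trans (exp2_le_growth _)) // ler_weXn2l ?growth_ge1.
move=> /le_trans h /h; rewrite -muln2 mulnC exprS exprM.
have : 0 < (2 ^+ 2) ^+ n :> rat by rewrite !exprn_gt0.
have -> : 2 ^+ 2 = 4 :> rat by [].
lra.
Qed.

End Potential.

Local Open Scope nat_scope.

(** * Acyclic graphs in tournaments *)

(** A vertex dominates, or is dominated by, at least half of the other vertices;
    it is put in front of, or behind, a transitive sequence found there. *)
Lemma transitive_subseq (U : finType) (T : rel U) (k : nat) (S : {set U}) :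
    (forall x y, x != y -> T x y || T y x) -> 2 ^ k <= #|S| ->
  exists s : seq U, [/\ size s = k, uniq s, {subset s <= S} & pairwise T s].
Proof.
move=> semi; elim: k S => [|k IH] S cS; first by exists [::].
have /card_gt0P[x xS] : 0 < #|S| by apply: leq_trans cS; rewrite expn_gt0.
pose O := [set y in S :\ x | T x y]; pose I := [set y in S :\ x | T y x].
have cOI : 2 ^ k.+1 <= (#|O| + #|I|).+1.
  apply: leq_trans cS _; rewrite (cardsD1 x) xS add1n ltnS.
  apply: leq_trans (leq_card_setU _ _); apply/subset_leq_card/subsetP => y yS.
  rewrite !inE; move: (yS); rewrite !inE => -> /=.
  by apply: semi; case/setD1P: yS; rewrite eq_sym.
have [cO|cO] := leqP (2 ^ k) #|O|.
  have [s [ss us sO ps]] := IH _ cO; exists (x :: s); split=> /=.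
  - by rewrite ss.
  - by rewrite us andbT; apply/negP => /sO; rewrite !inE eqxx.
  - by move=> y /predU1P[->//|/sO]; rewrite !inE => /andP[/andP[]].
  - by rewrite ps andbT; apply/allP => y /sO; rewrite inE => /andP[].
have [|s [ss us sI ps]] := IH I; first by move: cOI cO; rewrite expnS; lia.
exists (rcons s x); split=> /=.
- by rewrite size_rcons ss.
- by rewrite rcons_uniq us andbT; apply/negP => /sI; rewrite !inE eqxx.
- by move=> y; rewrite mem_rcons => /predU1P[->//|/sI]; rewrite !inE => /andP[/andP[]].
- by rewrite pairwise_rcons ps andbT; apply/allP => y /sI; rewrite inE => /andP[].
Qed.

Lemma averaging (I : finType) (f : I -> nat) (i0 : I) :
  exists i, \sum_j f j <= #|I| * f i.
Proof.
case: (@arg_maxnP _ i0 xpredT f isT) => i _ maxi; exists i.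
by rewrite -sum_nat_const; apply: leq_sum => j _; apply: maxi.
Qed.

(** * Two free vertices *)

Section TwoFreeVertices.
Variables (V : finType) (F : rel V) (N q : nat) (T : rel ('I_N * 'I_q)).
Variables (a c : V).
Hypotheses (neq_ac : a != c) (Fac : ~~ F a c) (Fca : ~~ F c a) (q_gt0 : 0 < q).

(** The host tournament has [N] disjoint blocks of [q] vertices.  A transversal
    [g] picks one vertex in each block, and [phi] tells which block receives
    which vertex of [V].  Separating the choice of the blocks from the choice
    inside the blocks makes every transversal an honest set of [N] distinct
    vertices, and makes the candidates for different vertices of [V] disjoint. *)
Definition embeds (phi : {ffun V -> 'I_N}) (g : {ffun 'I_N -> 'I_q}) : bool :=
  injectiveb phi &&
  [forall u, forall v, F u v ==> T (phi u, g (phi u)) (phi v, g (phi v))].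

Definition replace (phi : {ffun V -> 'I_N}) (g : {ffun 'I_N -> 'I_q}) (x y : 'I_q) :
    {ffun 'I_N -> 'I_q} :=
  [ffun i => if i == phi a then x else if i == phi c then y else g i].

(** Re-choosing the two coordinates [phi a] and [phi c] of a uniformly random
    transversal leaves it uniformly random. *)
Lemma sum_replace phi :
  \sum_g \sum_(z : 'I_q * 'I_q) embeds phi (replace phi g z.1 z.2)
  = q ^ 2 * \sum_g embeds phi g.
Proof.
have [inj|ninj] := boolP (injectiveb phi); last first.
  by rewrite /embeds (negbTE ninj) /= !big1 ?muln0 // => g _; rewrite big1.
have phi_ac : (phi c == phi a) = false.
  by apply/negbTE; rewrite eq_sym (inj_eq (injectiveP _ inj)).
rewrite pair_bigA /=.
(* Exchanging the new pair of coordinates with the old one is an involution. *)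
pose tau (p : {ffun 'I_N -> 'I_q} * ('I_q * 'I_q)) :=
  (replace phi p.1 p.2.1 p.2.2, (p.1 (phi a), p.1 (phi c))).
have tauK : involutive tau.
  case=> g [x y]; rewrite /tau /= !ffunE eqxx phi_ac eqxx; congr (_, _).
  apply/ffunP => i; rewrite !ffunE.
  by case: eqP => [->//|_]; case: eqP => [->|].
rewrite (reindex_inj (inv_inj tauK)) /=.
rewrite (eq_bigr (fun p => nat_of_bool (embeds phi p.1))); last first.
  by move=> p _; congr (nat_of_bool (embeds _ _)); have := tauK p; case: p => g [x y] [].
rewrite -(pair_bigA _ (fun g _ => nat_of_bool (embeds phi g))) /= big_distrr /=.
apply: eq_bigr => g _.
by rewrite sum_nat_const card_prod card_ord mulnn.
Qed.

(** Every transversal embeds [F] for one of the [N ^ #|V|] maps [phi], so by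
    [sum_replace] some [phi] and [g] admit at least [q ^ 2 / N ^ #|V|] good pairs
    of replacements.  The coordinates [X] and [Y] of the good pairs are then
    large.  Conversely any [x] in [X] and [y] in [Y] form a good pair, since each
    edge of [F] misses [a] or [c]: it sees only one of the two replacements. *)
Lemma two_free_vertices :
    (forall g, exists phi, embeds phi g) ->
  exists phi g (X Y : {set 'I_q}),
    [/\ q <= N ^ #|V| * #|X|, q <= N ^ #|V| * #|Y| &
        forall x y, x \in X -> y \in Y -> embeds phi (replace phi g x y)].
Proof.
move=> HR; set M := N ^ #|V|.
pose G := {ffun 'I_N -> 'I_q}; pose Phi := {ffun V -> 'I_N}.
pose f (p : Phi * G) := \sum_(z : 'I_q * 'I_q) embeds p.1 (replace p.1 p.2 z.1 z.2).
pose g0 : G := [ffun=> Ordinal q_gt0]; have [phi0 _] := HR g0.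
have [[phi g] avg] := averaging f (phi0, g0).
have {avg}cM : q ^ 2 <= M * f (phi, g).
  have qN : 0 < q ^ N by rewrite expn_gt0 q_gt0.
  rewrite -(leq_pmul2r qN) (leq_trans _ (leq_trans avg _)) //; last first.
    by rewrite card_prod !card_ffun !card_ord /M mulnAC.
  rewrite /f -(pair_bigA _ (fun phi g =>
     \sum_(z : 'I_q * 'I_q) embeds phi (replace phi g z.1 z.2))) /=.
  rewrite (eq_bigr _ (fun phi _ => sum_replace phi)) -big_distrr /= leq_mul2l.
  apply/orP; right; rewrite exchange_big /=.
  apply: leq_trans (_ : \sum_(g : G) 1 <= _).
    by rewrite sum1_card card_ffun !card_ord.
  apply: leq_sum => g1 _; have [phi1 emb] := HR g1.
  by rewrite (bigD1 phi1) //= emb.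
pose X := [set x | [exists y, embeds phi (replace phi g x y)]].
pose Y := [set y | [exists x, embeds phi (replace phi g x y)]].
have cXY : f (phi, g) <= #|X| * #|Y|.
  rewrite -cardsX /f -sum1_card big_mkcond [leqRHS]big_mkcond /=.
  apply: leq_sum => -[x y] _; rewrite in_setX !inE /=.
  case emb: (embeds _ _) => //.
  suff [-> ->] : [exists y0, embeds phi (replace phi g x y0)] /\
    [exists x0, embeds phi (replace phi g x0 y)] by [].
  by split; apply/existsP; [exists y | exists x].
have card_le (Z : {set 'I_q}) : #|Z| <= q by rewrite -[leqRHS]card_ord max_card.
have leq2 : q ^ 2 <= M * (#|X| * #|Y|) by apply: leq_trans cM _; rewrite leq_mul2l cXY orbT.
exists phi, g, X, Y; split.
- by rewrite -(leq_pmul2r q_gt0) mulnn (leq_trans leq2) // mulnA leq_mul2l card_le orbT.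
- rewrite -(leq_pmul2r q_gt0) mulnn (leq_trans leq2) // mulnAC mulnA leq_mul2r.
  by rewrite leq_mul2l card_le !orbT.
move=> x y; rewrite !inE.
case/existsP=> y' /andP[inj /'forall_forallP embx] /existsP[x' /andP[_ /'forall_forallP emby]].
rewrite /embeds inj /=; apply/'forall_forallP => u v; apply/implyP => Fuv.
have ph := inj_eq (injectiveP _ inj).
have agreex w : w != c -> replace phi g x y (phi w) = replace phi g x y' (phi w).
  by move=> wc; rewrite !ffunE !ph (negbTE wc).
have agreey w : w != a -> replace phi g x y (phi w) = replace phi g x' y (phi w).
  by move=> wa; rewrite !ffunE !ph (negbTE wa).
(* An edge that avoids c is checked with the partner y' of x, and an edge that
   meets c avoids a and is checked with the partner x' of y. *)
have [|] := boolP ((u != c) && (v != c)).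
  by case/andP=> uc vc; rewrite !agreex //; apply: implyP (embx u v) Fuv.
rewrite negb_and !negbK => uvc.
have [ua va] : u != a /\ v != a.
  split; apply: contraTneq Fuv => eqa.
    by move: uvc; rewrite eqa (negbTE neq_ac) /= => /eqP->.
  by move: uvc; rewrite eqa (negbTE neq_ac) orbF => /eqP->.
by rewrite !agreey //; apply: implyP (emby u v) Fuv.
Qed.

End TwoFreeVertices.

(** * Graphs with a single backward edge *)

Lemma FAS_witness (V : finType) (E : rel V) :
  exists2 sigma : {ffun V -> 'I_#|V|}, injective sigma & FAS_ord E sigma = FAS E.
Proof.
rewrite /FAS; case: arg_minnP => [|s /injectiveP inj _]; last by exists s.
by apply/injectiveP => u v; rewrite !ffunE => /enum_rank_inj.
Qed.

Lemma FAS1_back_edge (V : finType) (E : rel V) :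
    irreflexive E -> FAS E = 1 ->
  exists (sigma : {ffun V -> 'I_#|V|}) (a c : V),
    [/\ injective sigma, E a c &
        forall u v, E u v -> (u, v) != (a, c) -> sigma u < sigma v].
Proof.
move=> irr; have [s inj <-] := FAS_witness E.
move=> /eqP/cards1P[[a c] back]; exists s, a, c; split=> //.
  by have := set11 (a, c); rewrite -back inE => /andP[].
move=> u v Euv ne; rewrite ltn_neqAle leqNgt; apply/andP; split.
  by apply: contraTneq Euv => /val_inj/inj->; rewrite irr.
by apply: contra ne => lt; rewrite -in_set1 -back inE /= Euv.
Qed.

(** Apply [transitive_subseq] to the tournament that [T] induces on the [2 ^ #|V|]
    vertices of the transversal. *)
Lemma acyclic_embeds (V : finType) (F : rel V) (sigma : V -> 'I_#|V|) (q : nat)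
    (T : rel ('I_(2 ^ #|V|) * 'I_q)) :
    injective sigma -> (forall u v, F u v -> sigma u < sigma v) ->
    (forall p r, p != r -> T p r || T r p) ->
  forall g, exists phi, embeds F T phi g.
Proof.
move=> inj fwd semi g.
pose U i j := T (i, g i) (j, g j).
have [||s [ss us _ ps]] := @transitive_subseq _ U #|V| [set: 'I_(2 ^ #|V|)].
- by move=> i j ij; apply: semi; apply: contraNneq ij => -[->].
- by rewrite cardsT card_ord.
have i0 : 'I_(2 ^ #|V|) by exists 0; rewrite expn_gt0.
exists [ffun v => nth i0 s (sigma v)]; apply/andP; split.
  apply/injectiveP => u v; rewrite !ffunE => /eqP.
  by rewrite nth_uniq ?ss // => /eqP/val_inj/inj.
apply/'forall_forallP => u v; apply/implyP => Fuv; rewrite !ffunE.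
by move/(pairwiseP i0): ps => /(_ (sigma u) (sigma v)); apply; rewrite ?inE ?ss ?fwd.
Qed.

(** The free vertices of the graph without its backward edge [a -> c] are
    completed by an edge of the rectangle of candidates, which
    [low_potential_edge] provides.  That the opposite edge [c -> a] is absent is
    what makes [a] and [c] non-adjacent in [F]. *)
Lemma copy_of_FAS1 (n b : nat) (V : finType) (E : rel V) (D : {set 'I_n * 'I_n}) :
    let N := 2 ^ #|V| in let q := n %/ N in let M := N ^ #|V| in
    oriented_graph E -> FAS E = 1 -> 0 < q ->
    M ^ 2 * (b.+1.*2 * n.*2.+1) <= q ^ 2 ->
    game_over D -> (potential b D <= 4 ^+ n)%R -> has_copy E D.
Proof.
move=> N q M [irr orient] fas q0 big over low.
have [s [a [c [inj Eac fwd]]]] := FAS1_back_edge irr fas.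
have neq_ac : a != c by apply: contraTneq Eac => ->; rewrite irr.
pose F : rel V := fun u v => E u v && ((u, v) != (a, c)).
have cardP : #|{: 'I_N * 'I_q}| <= n by rewrite card_prod !card_ord mulnC leq_divM.
pose pt (p : 'I_N * 'I_q) : 'I_n := widen_ord cardP (enum_rank p).
have pt_inj : injective pt by move=> p r /(congr1 val)/= /val_inj/enum_rank_inj.
pose T : rel ('I_N * 'I_q) := fun p r => (pt p, pt r) \in D.
have Fac : ~~ F a c by rewrite /F eqxx andbF.
have Fca : ~~ F c a by rewrite /F negb_and; have := orient a c; rewrite Eac /= => ->.
have HR : forall g, exists phi, embeds F T phi g.
  apply: (acyclic_embeds inj) => [u v /andP[]|p r pr]; first exact: fwd.
  by apply: (game_over_edge over); rewrite (inj_eq pt_inj).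
have [phi [g [X [Y [cX cY emb]]]]] := two_free_vertices neq_ac Fac Fca q0 HR.
pose in_block v (Z : {set 'I_q}) := [set pt (phi v, z) | z in Z].
have card_block v Z : #|in_block v Z| = #|Z|.
  by rewrite card_imset // => x y /pt_inj[].
have M0 : 0 < M by rewrite !expn_gt0.
have bigXY : b.+1.*2 * n.*2.+1 <= #|in_block a X| * #|in_block c Y|.
  rewrite !card_block -(leq_pmul2l (_ : 0 < M ^ 2)) ?expn_gt0 ?M0 //.
  by rewrite (leq_trans big) // expnS expn1 -mulnn mulnACA leq_mul.
have phi_inj : injective phi.
  have [x xX] : exists x, x \in X.
    by apply/card_gt0P; rewrite lt0n; apply: contraTneq cX => ->; rewrite muln0 -ltnNge.
  have [y yY] : exists y, y \in Y.
    by apply/card_gt0P; rewrite lt0n; apply: contraTneq cY => ->; rewrite muln0 -ltnNge.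
  by have /andP[/injectiveP] := emb x y xX yY.
have dXY : [disjoint in_block a X & in_block c Y].
  apply/pred0Pn => -[_ /andP[/imsetP[x _ ->] /imsetP[y _ /pt_inj[/phi_inj eq_ac _]]]].
  by rewrite eq_ac eqxx in neq_ac.
have [_ /imsetP[x xX ->] [_ /imsetP[y yY ->] xyD]] := low_potential_edge over low dXY bigXY.
have /andP[_ /'forall_forallP embF] := emb x y xX yY.
pose h := replace a c phi g x y.
exists (fun v => pt (phi v, h (phi v))); first by move=> u v /pt_inj[/phi_inj].
move=> u v Euv; have [[-> ->]|ne] := eqVneq (u, v) (a, c).
  by rewrite !ffunE !(inj_eq phi_inj) !eqxx eq_sym (negbTE neq_ac).
by apply: (implyP (embF u v)); rewrite /F Euv.
Qed.

(** The constant 48 is [4 * 4 * 3]: rounding costs a factor 2 in [n / N], hence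
    4 in its square, and [2 * (b + 1) <= 4 * b], [2 * n + 1 <= 3 * n]. *)
Lemma linear_bias_bounds (n b N M : nat) :
    0 < N -> 0 < M -> 0 < b -> 48 * (N * M) ^ 2 * b <= n ->
  0 < n %/ N /\ M ^ 2 * (b.+1.*2 * n.*2.+1) <= (n %/ N) ^ 2.
Proof.
move=> N0 M0 b0 le_n.
have leNn : N <= n.
  apply: leq_trans le_n.
  have -> : 48 * (N * M) ^ 2 * b = N * (48 * N * M ^ 2 * b) by ring.
  by rewrite leq_pmulr // !muln_gt0 N0 M0 b0.
have q0 : 0 < n %/ N by rewrite divn_gt0.
split=> //; set q := n %/ N in q0 *.
have n0 : 0 < n by apply: leq_trans leNn.
have le_nq : n <= 2 * N * q.
  apply: leq_trans (ltnW (ltn_ceil n N0)) _; rewrite -/q; nia.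
rewrite -(leq_pmul2l (_ : 0 < 4 * N ^ 2)) ?muln_gt0 ?expn_gt0 ?N0 //.
have -> : 4 * N ^ 2 * q ^ 2 = (2 * N * q) ^ 2 by ring.
apply: (@leq_trans (n * n)); last by rewrite -mulnn leq_mul.
apply: (@leq_trans (48 * (N * M) ^ 2 * b * n)); last by rewrite leq_mul2r le_n orbT.
have -> : 48 * (N * M) ^ 2 * b * n = 4 * N ^ 2 * (M ^ 2 * (4 * b * (3 * n))).
  by ring.
rewrite !leq_pmul2l ?muln_gt0 ?expn_gt0 ?N0 ?M0 //.
by apply: leq_mul; lia.
Qed.

Lemma maker_wins_linear_bias (n b : nat) (V : finType) (E : rel V) :
    let N := 2 ^ #|V| in let M := N ^ #|V| in
    oriented_graph E -> FAS E = 1 -> 0 < b -> 48 * (N * M) ^ 2 * b <= n ->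
  maker_wins n b E.
Proof.
move=> N M HE HFAS b0 le_n.
have N0 : 0 < N by rewrite expn_gt0.
have M0 : 0 < M by rewrite expn_gt0 N0.
have n0 : 0 < n.
  by apply: leq_trans le_n; rewrite !muln_gt0 N0 M0 b0.
have [q0 big] := linear_bias_bounds N0 M0 b0 le_n.
have [S legal low] := maker_controls_potential b n0.
exists S => // h ph over.
exact: copy_of_FAS1 HE HFAS q0 big over (low h ph).
Qed.

Local Close Scope nat_scope.

Theorem proposition5p4 (R : realType) (V : finType) (E : rel V)
    (HE : oriented_graph E) (HFAS : FAS E = 1%N) :
  exists2 gamma : R, 0 < gamma &
    forall n : nat, (0 < n)%N -> 1 <= gamma * n%:R ->
      maker_wins n (Num.truncn (gamma * n%:R)) E.
Proof.
pose N := (2 ^ #|V|)%N; pose M := (N ^ #|V|)%N.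
pose C := (48 * (N * M) ^ 2)%N.
have C0 : 0 < C%:R :> R.
  by rewrite ltr0n /C muln_gt0 expn_gt0 muln_gt0 !expn_gt0.
exists C%:R^-1; first by rewrite invr_gt0.
move=> n _ ge1; apply: maker_wins_linear_bias => //; first by rewrite truncn_gt0.
rewrite -(ler_nat R) natrM -ler_pdivlMl // truncn_le.
by rewrite mulr_ge0 // invr_ge0 ltW.
Qed.
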